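(* Let $m\in\mathbb{N}$, let $\{K_\epsilon^{\mathbb{T}}:0<\epsilon\le1\}$ be an $m$th order kernel for $[-\pi,\pi]_{\mathrm{per}}$, let $\theta_0\in[-\pi,\pi]_{\mathrm{per}}$ and $g\in L^2(\Omega,\omega)$. Let $\mathcal{K}$ be the unitary Koopman operator on $L^2(\Omega,\omega)$ with spectral measure $\mathcal{E}$, and let $g_\theta^\epsilon=[K_\epsilon^{\mathbb{T}}*\mathcal{E}](\theta)g$. Suppose that $$\liminf_{\epsilon\downarrow0}\ \inf_{|\theta|<\eta\epsilon}\epsilon|K_\epsilon^{\mathbb{T}}(\theta)|>0\ \text{ for some }\eta>0,\qquad\text{and}\qquad \liminf_{c\downarrow0}\frac{\xi_g([\theta_0-c,\theta_0+c])}{c^2}>0.$$ Then $$\lim_{\epsilon\downarrow0}\frac{\|(\mathcal{K}-e^{i\theta_0}I)g_{\theta_0}^\epsilon\|}{\|g_{\theta_0}^\epsilon\|}=0,$$ i.e., $g_{\theta_0}^\epsilon/\|g_{\theta_0}^\epsilon\|$ is an approximate eigenvector sequence.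
   Context: Setting: $\Omega\subseteq\mathbb{R}^d$, $F:\Omega\to\Omega$ preserves a Borel measure $\omega$ and is invertible modulo $\omega$-null sets, so the Koopman operator $[\mathcal{K}g](x)=g(F(x))$ is unitary on $L^2(\Omega,\omega)$ (norm $\|\cdot\|$). $[-\pi,\pi]_{\mathrm{per}}$ is the periodic interval. $\mathcal{E}$ is the projection-valued spectral measure of $\mathcal{K}$ in the angle coordinate ($\lambda=e^{i\varphi}$), so $\mathcal{K}=\int_{[-\pi,\pi]_{\mathrm{per}}}e^{i\varphi}d\mathcal{E}(\varphi)$; $\xi_g(S)=\langle\mathcal{E}(S)g,g\rangle$; $[k*\mathcal{E}](\theta)=\int_{[-\pi,\pi]_{\mathrm{per}}}k(\theta-\varphi)\,d\mathcal{E}(\varphi)$. $m$th order kernel for $[-\pi,\pi]_{\mathrm{per}}$: a family $\{K_\epsilon^{\mathbb{T}}:0<\epsilon\le1\}$ of continuous functions on $[-\pi,\pi]_{\mathrm{per}}$ such that (i) $\int_{-\pi}^{\pi}K_\epsilon^{\mathbb{T}}(\theta)d\theta=1$; (ii) there is a constant $C_K$ such that for each integer $n=1,\ldots,m-1$, $|\int_{-\pi}^{\pi}K_\epsilon^{\mathbb{T}}(-\theta)e^{in\theta}d\theta-1|\le C_K\epsilon^m\log(1+\epsilon^{-1})$; (iii) $|K_\epsilon^{\mathbb{T}}(\theta)|\le C_K\epsilon^m(\epsilon+|\theta|)^{-(m+1)}$ for all $\theta\in[-\pi,\pi]$, $0<\epsilon\le1$. *)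

(* Defs.v *)
From HB Require Import structures.
From mathcomp Require Import all_boot all_order all_algebra ring_quotient.
From mathcomp Require Import all_classical all_reals all_analysis.
From mathcomp Require Import measurable_realfun complex ring.

Set Implicit Arguments.
Unset Strict Implicit.
Unset Printing Implicit Defensive.
Import Order.TTheory GRing.Theory Num.Theory.
Import numFieldNormedType.Exports.

Local Open Scope classical_set_scope.
Local Open Scope ring_scope.
Local Open Scope complex_scope.
Local Open Scope quotient_scope.

(* [normc] takes its values in R, whereas [`|z|] lives in R[i]. *)
Notation normc := ComplexField.Normc.normc.
Local Notation Re := complex.Re.
Local Notation Im := complex.Im.

Definition cintegral {d} {T : measurableType d} {R : realType}
    (mu : {measure set T -> \bar R}) (D : set T) (f : T -> R[i]) : R[i] :=
  (\int[mu]_(x in D) Re (f x)) +i* (\int[mu]_(x in D) Im (f x)).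

Definition expi {R : realType} (t : R) : R[i] := cos t +i* sin t.

(* The Borel sigma-algebra of the subspace topology on a nonempty subset A;
   measurable types have to be pointed. *)
Section borel_subset.
Context {X : topologicalType} {A : set X}.

Definition pointed_subset (A0 : A !=set0) : Type := set_type A.

Lemma subset_inhabited (A0 : A !=set0) : inhabited (set_type A).
Proof. by case: A0 => a Aa; split; exists a; exact: mem_set. Qed.

HB.instance Definition _ (A0 : A !=set0) :=
  Choice.copy (pointed_subset A0) (set_type A).
HB.instance Definition _ (A0 : A !=set0) :=
  isPointed.Build (pointed_subset A0) (inhabited_witness (subset_inhabited A0)).

Definition borel_subset (A0 : A !=set0) :=
  g_sigma_algebraType
    (@open (set_type A) : set (set (pointed_subset A0))).

HB.instance Definition _ (A0 : A !=set0) := Measurable.on (borel_subset A0).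

End borel_subset.

Section L2.
Context {d} {T : measurableType d} {R : realType}.
Variable mu : {measure set T -> \bar R}.
Local Notation C := R[i].

(* f is in L^2(mu; C) iff Re f and Im f are in L^2(mu; R), since
   |f|^2 = (Re f)^2 + (Im f)^2. *)
Definition isL2 : {pred T -> C} :=
  [pred f : T -> C | ((@complex.Re R \o f) \in Lfun mu 2%:E)
                  && ((@complex.Im R \o f) \in Lfun mu 2%:E)].

Let le12 : (1 <= 2%:E :> \bar R)%E. Proof. by rewrite lee_fin ler1n. Qed.

Lemma LfunD (f g : T -> R) : f \in Lfun mu 2%:E -> g \in Lfun mu 2%:E ->
  f \+ g \in Lfun mu 2%:E.
Proof.
have [_ cl] := Lfun_submod_closed mu le12.
by move=> fL gL; have := cl 1 f g fL gL; rewrite scale1r.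
Qed.

Lemma LfunZ (a : R) (f : T -> R) : f \in Lfun mu 2%:E ->
  (fun x => a * f x) \in Lfun mu 2%:E.
Proof.
have [c0 cl] := Lfun_submod_closed mu le12.
by move=> fL; have := cl a f 0 fL c0; rewrite addr0.
Qed.

Lemma isL2_submod_closed : submod_closed isL2.
Proof.
have [c0 _] := Lfun_submod_closed mu le12.
split; first by rewrite inE /=; apply/andP; split; exact: c0.
move=> a f g; rewrite !inE => /andP[fr fi] /andP[gr gi]; apply/andP; split.
  have -> : @complex.Re R \o (a *: f + g) =
      ((fun x => Re a * Re (f x)) \+ (fun x => - Im a * Im (f x))) \+ (@complex.Re R \o g).
    apply/funext => x /=; rewrite !fctE; case: a (f x) (g x) => [a b] [p q] [r s] /=.
    by rewrite mulNr.
  by apply: LfunD => //; apply: LfunD; exact: LfunZ.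
have -> : @complex.Im R \o (a *: f + g) =
    ((fun x => Re a * Im (f x)) \+ (fun x => Im a * Re (f x))) \+ (@complex.Im R \o g).
  by apply/funext => x /=; rewrite !fctE; case: a (f x) (g x) => [a b] [p q] [r s].
by apply: LfunD => //; apply: LfunD; exact: LfunZ.
Qed.

HB.instance Definition _ :=
  GRing.isSubmodClosed.Build _ _ isL2 isL2_submod_closed.

Record L2fun := MkL2fun { L2fun_val :> T -> C ; _ : L2fun_val \in isL2 }.
HB.instance Definition _ := [isSub for L2fun_val].
HB.instance Definition _ := [Choice of L2fun by <:].
HB.instance Definition _ := [SubChoice_isSubLmodule of L2fun by <:].

Definition L2null : {pred L2fun} :=
  [pred f : L2fun | `[< {ae mu, forall x, f x = 0} >]].

Lemma L2null_zmod_closed : zmod_closed L2null.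
Proof.
split; first by rewrite inE; apply: aeW.
move=> f g; rewrite !inE => f0 g0.
by apply: filterS2 f0 g0 => x /= fx gx; rewrite !fctE fx gx subrr.
Qed.

HB.instance Definition _ :=
  GRing.isZmodClosed.Build _ L2null L2null_zmod_closed.

Lemma L2nullZ (a : C) (f : L2fun) : f \in L2null -> a *: f \in L2null.
Proof.
rewrite !inE => f0.
by apply: filterS f0 => x /= fx; rewrite fctE fx scaler0.
Qed.

Definition L2 : Type := Quotient.quot L2null.
HB.instance Definition _ := EqQuotient.on L2.
HB.instance Definition _ := ZmodQuotient.on L2.

Lemma L2_eqP (f g : L2fun) : \pi_L2 f = \pi_L2 g <-> {ae mu, forall x, f x = g x}.
Proof.
split=> [/eqP|fg].
  rewrite -Quotient.idealrBE inE; apply: filterS => x /= /eqP.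
  by rewrite !fctE subr_eq0 => /eqP.
apply/eqP; rewrite -Quotient.idealrBE inE; apply: filterS fg => x /= fg.
by rewrite !fctE fg subrr.
Qed.

Definition L2repr (u : L2) : L2fun := repr u.
Coercion L2repr : L2 >-> L2fun.

Lemma L2reprK (f : L2fun) : {ae mu, forall x, (\pi_L2 f : L2) x = f x}.
Proof. by apply/L2_eqP; rewrite reprK. Qed.

Lemma pi_L2D (f g : L2fun) : \pi_L2 (f + g) = \pi_L2 f + \pi_L2 g.
Proof. exact: Quotient.pi_add. Qed.

Definition L2scale (a : C) (u : L2) : L2 := \pi_L2 (a *: (u : L2fun)).

Lemma pi_L2scale (a : C) (f : L2fun) : \pi_L2 (a *: f) = L2scale a (\pi_L2 f).
Proof.
apply/L2_eqP; apply: filterS (L2reprK f) => x /= fx.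
by rewrite !fctE fx.
Qed.

Let L2scaleA a b u : L2scale a (L2scale b u) = L2scale (a * b) u.
Proof. by rewrite -[u]reprK -(pi_L2scale b) -!pi_L2scale scalerA. Qed.
Let L2scale1 : left_id 1 L2scale.
Proof. by move=> u; rewrite -[u]reprK -!pi_L2scale scale1r. Qed.
Let L2scaleDr : right_distributive L2scale +%R.
Proof.
move=> a u v; rewrite -[u]reprK -[v]reprK -pi_L2D -!pi_L2scale scalerDr.
by rewrite pi_L2D.
Qed.
Let L2scaleDl u : {morph L2scale^~ u : a b / a + b}.
Proof. by move=> a b; rewrite -[u]reprK -!pi_L2scale scalerDl pi_L2D. Qed.

HB.instance Definition _ := GRing.Zmodule_isLmodule.Build C L2
  L2scaleA L2scale1 L2scaleDr L2scaleDl.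

End L2.

Section inner_product.
Context {d} {T : measurableType d} {R : realType}.
Variable mu : {measure set T -> \bar R}.
Local Notation C := R[i].
Local Notation L2 := (L2 mu).
Implicit Types u v w : L2.

(* Linear in the first argument. *)
Definition dot u v : C := cintegral mu setT (fun x => u x * (v x)^*).

Definition L2norm u : R := Num.sqrt (Re (dot u u)).

Lemma L2_Re_Lfun (f : L2fun mu) : @complex.Re R \o f \in Lfun mu 2%:E.
Proof. by case: f => f /=; rewrite inE => /andP[]. Qed.

Lemma L2_Im_Lfun (f : L2fun mu) : @complex.Im R \o f \in Lfun mu 2%:E.
Proof. by case: f => f /=; rewrite inE => /andP[]. Qed.

Lemma integrable_dot (f g : L2fun mu) :
  mu.-integrable setT (fun x => (Re (f x * (g x)^*))%:E) /\
  mu.-integrable setT (fun x => (Im (f x * (g x)^*))%:E).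
Proof.
have M (a b : T -> R) : a \in Lfun mu 2%:E -> b \in Lfun mu 2%:E ->
    mu.-integrable setT (fun x => (a x * b x)%:E).
  by move=> aL bL; apply/Lfun1_integrable; exact: Lfun2_mul_Lfun1.
split.
  rewrite (_ : (fun x => _) = ((fun x => (Re (f x) * Re (g x))%:E) \+
      (fun x => (Im (f x) * Im (g x))%:E))%E); last first.
    apply/funext => x /=; case: (f x) (g x) => [a b] [p q] /=.
    by rewrite mulrN opprK.
  by apply: integrableD => //; apply: M; rewrite ?L2_Re_Lfun ?L2_Im_Lfun.
rewrite (_ : (fun x => _) = ((fun x => (Im (f x) * Re (g x))%:E) \-
    (fun x => (Re (f x) * Im (g x))%:E))%E); last first.
  apply/funext => x /=; case: (f x) (g x) => [a b] [p q] /=.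
  by rewrite mulrN addrC.
by apply: integrableB => //; apply: M; rewrite ?L2_Re_Lfun ?L2_Im_Lfun.
Qed.

Lemma dot_pi (f g : L2fun mu) :
  dot (\pi_L2 f) (\pi_L2 g) = cintegral mu setT (fun x => f x * (g x)^*).
Proof.
have [rm im] := integrable_dot f g.
have [rm' im'] := integrable_dot (\pi_L2 f : L2) (\pi_L2 g : L2).
have E : {ae mu, forall x, (\pi_L2 f : L2) x * ((\pi_L2 g : L2) x)^* =
                           f x * (g x)^*}.
  by apply: filterS2 (L2reprK f) (L2reprK g) => x /= -> ->.
rewrite /dot /cintegral; congr (_ +i* _); congr fine; apply: ae_eq_integral => //.
- exact: measurable_int rm'.
- exact: measurable_int rm.
- by apply: filterS E => x /= -> _.
- exact: measurable_int im'.
- exact: measurable_int im.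
- by apply: filterS E => x /= -> _.
Qed.

Lemma dotDl u v w : dot (u + v) w = dot u w + dot v w.
Proof.
rewrite -[u]reprK -[v]reprK -[w]reprK -pi_L2D !dot_pi.
set f := repr u; set g := repr v; set h := repr w.
have [r1 i1] := integrable_dot f h; have [r2 i2] := integrable_dot g h.
rewrite /cintegral; apply/eqP; rewrite eq_complex /=.
rewrite -!RintegralD //; apply/andP; split; apply/eqP; apply: eq_Rintegral => x _.
  by rewrite !fctE mulrDl; case: (f x * _) (g x * _) => [? ?] [].
by rewrite !fctE mulrDl; case: (f x * _) (g x * _) => [? ?] [].
Qed.

Lemma dotC u v : dot u v = (dot v u)^*.
Proof.
have [_ i1] := integrable_dot v u.
rewrite /dot /cintegral; apply/eqP; rewrite eq_complex /=; apply/andP; split.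
  apply/eqP; apply: eq_Rintegral => x _.
  by case: (u x) (v x) => [a b] [p q] /=; ring.
rewrite -mulN1r -RintegralZl //; apply/eqP; apply: eq_Rintegral => x _.
by case: (u x) (v x) => [a b] [p q] /=; ring.
Qed.

Lemma dotZl (a : C) u v : dot (a *: u) v = a * dot u v.
Proof.
set f := repr u; set g := repr v.
have -> : a *: u = \pi_L2 (a *: f) by [].
have [<- <-] : \pi_L2 f = u /\ \pi_L2 g = v by rewrite !reprK.
rewrite !dot_pi; have [r1 i1] := integrable_dot f g.
have Z (k : R) (h : T -> R) : mu.-integrable setT (EFin \o h) ->
    mu.-integrable setT (EFin \o (fun x => k * h x)).
  by move=> hi; have := integrableZl measurableT k hi.
rewrite /cintegral; case: a => a b; apply/eqP; rewrite eq_complex /=.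
rewrite -!RintegralZl //; apply/andP; split; apply/eqP.
  rewrite -RintegralB //; [|exact: Z..].
  apply: eq_Rintegral => x _.
  by rewrite !fctE; case: (f x) (g x) => [? ?] [? ?] /=; ring.
rewrite -RintegralD //; [|exact: Z..].
apply: eq_Rintegral => x _.
by rewrite !fctE; case: (f x) (g x) => [? ?] [? ?] /=; ring.
Qed.

Lemma dotDr u v w : dot u (v + w) = dot u v + dot u w.
Proof. by rewrite dotC dotDl (dotC u v) (dotC u w); exact: raddfD. Qed.

Lemma dotZr (a : C) u v : dot u (a *: v) = a^* * dot u v.
Proof. by rewrite dotC dotZl (dotC u v); exact: rmorphM. Qed.

Lemma dot_ge0 u : 0 <= Re (dot u u).
Proof.
apply: Rintegral_ge0 => x _; case: (u x) => a b /=.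
by rewrite mulrN opprK addr_ge0 // -expr2 sqr_ge0.
Qed.

Lemma Re_dot_le u v : `|Re (dot u v)| <= L2norm u * L2norm v.
Proof.
rewrite -sqrtrM ?dot_ge0 // -sqrtr_sqr ler_sqrt ?mulr_ge0 ?dot_ge0 //.
set a := Re (dot u u); set b := Re (dot u v); set c := Re (dot v v).
have E (t : R) : 0 <= a + (t * b) *+ 2 + t ^+ 2 * c.
  have := dot_ge0 (u + t%:C *: v).
  rewrite dotDl !dotDr !dotZl !dotZr (dotC v u) /a /b /c.
  case: (dot u u) (dot u v) (dot v v) => [? ?] [? ?] [? ?] /=.
  by congr (_ <= _); ring.
have [c0|c0] := eqVneq c 0.
  have [b0|b0] := eqVneq b 0; first by rewrite b0 c0 mulr0 expr0n.
  have := E (- (a + 1) / (b *+ 2)).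
  rewrite c0 mulr0 addr0.
  have -> : a + (- (a + 1) / (b *+ 2) * b) *+ 2 = -1 by field.
  by rewrite ler0N1.
have cp : 0 < c by rewrite lt_neqAle eq_sym c0 dot_ge0.
have := E (- b / c).
have -> : a + (- b / c * b) *+ 2 + (- b / c) ^+ 2 * c = (a * c - b ^+ 2) / c.
  by field.
by rewrite pmulr_lge0 ?invr_gt0 // subr_ge0.
Qed.

End inner_product.
Arguments dot {d T R mu} u v : simpl never.

Section projection_valued_measure.
Context {d} {T : measurableType d} {R : realType}.
Variable mu : {measure set T -> \bar R}.
Context {dX} {X : measurableType dX}.
Local Notation L2 := (L2 mu).

Record pvm := Pvm {
  pvm_val :> set X -> L2 -> L2 ;
  pvm_linear : forall S, measurable S -> linear (pvm_val S) ;
  pvm_selfadjoint : forall S, measurable S ->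
    forall u v, dot (pvm_val S u) v = dot u (pvm_val S v) ;
  pvm0 : forall u, pvm_val set0 u = 0 ;
  pvmT : forall u, pvm_val setT u = u ;
  (* with A = B, this is the idempotence of each projection *)
  pvmI : forall A B, measurable A -> measurable B ->
    forall u, pvm_val (A `&` B) u = pvm_val A (pvm_val B u) ;
  pvm_sigma_additive : forall A : nat -> set X,
    (forall i, measurable (A i)) -> trivIset setT A ->
    forall u, (fun n => L2norm (pvm_val (\bigcup_i A i) u
                                - \sum_(i < n) pvm_val (A i) u)) @ \oo --> 0
}.

Variable E : pvm.

(* The value 0 off the sigma-algebra is a convention. *)
Definition spectral_measure (u : L2) (S : set X) : \bar R :=
  if `[< measurable S >] then (Re (dot (E S u) u))%:E else 0%E.

Section spectral_measure_is_measure.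
Variable u : L2.

Let spectral0 : spectral_measure u set0 = 0%E.
Proof.
rewrite /spectral_measure pvm0; case: ifP => // _.
by rewrite -(scale0r (0 : L2)) dotZl mul0r.
Qed.

Let spectral_ge0 S : (0 <= spectral_measure u S)%E.
Proof.
rewrite /spectral_measure; case: ifP => // /asboolP mS.
by rewrite -{1}(setIid S) pvmI // pvm_selfadjoint // lee_fin dot_ge0.
Qed.

Let dot_sum (h : nat -> L2) n :
  Re (dot (\sum_(i < n) h i) u) = \sum_(i < n) Re (dot (h i) u).
Proof.
elim: n => [|n ih].
  by rewrite !big_ord0 -(scale0r (0 : L2)) dotZl mul0r.
rewrite !big_ord_recr -ih; set v := (\sum_(i < n) h i); set w := h ord_max.
by change (Re (dot (v + w) u) = Re (dot v u) + Re (dot w u)); rewrite dotDl raddfD.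
Qed.

Let spectral_sigma_additive : semi_sigma_additive (spectral_measure u).
Proof.
move=> A mA tA mUA.
have sE S : measurable S -> spectral_measure u S = (Re (dot (E S u) u))%:E.
  by rewrite /spectral_measure => mS; case: ifPn => // /asboolP.
rewrite sE //.
rewrite (_ : (fun n => _) =
    EFin \o (fun n => Re (dot (\sum_(i < n) E (A i) u) u))); last first.
  apply/funext => n; rewrite big_mkord.
  transitivity ((\sum_(i < n) Re (dot (E (A i) u) u))%:E).
    by rewrite -sumEFin; apply: eq_bigr => i _; rewrite sE.
  by rewrite -(dot_sum (fun i => E (A i) u)).
apply: cvg_EFin; first exact: nearW.
apply/cvgrPdist_le => e e0 /=.
have /cvgrPdist_le h := pvm_sigma_additive E mA tA u.
have N0 : 0 <= L2norm u by exact: sqrtr_ge0.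
have d0 : 0 < e / (L2norm u + 1) by rewrite divr_gt0 // ltr_wpDl.
have := h _ d0; apply: filterS => n /=.
rewrite sub0r normrN ger0_norm ?sqrtr_ge0 // => hn.
have -> : Re (dot (E (\bigcup_n A n) u) u) -
     Re (dot (\sum_(i < n) E (A i) u) u) =
   Re (dot (E (\bigcup_n A n) u - \sum_(i < n) E (A i) u) u).
  set v := \sum_(i < n) _.
  by rewrite dotDl -(scaleN1r v) dotZl mulN1r raddfD raddfN.
apply: le_trans (Re_dot_le _ _) _.
apply: le_trans (ler_wpM2r N0 hn) _.
rewrite -mulrA ler_piMr ?(ltW e0) // mulrC ler_pdivrMr ?mul1r ?lerDl //.
by rewrite ltr_wpDl.
Qed.

HB.instance Definition _ := isMeasure.Build _ _ _ (spectral_measure u)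
  spectral0 spectral_ge0 spectral_sigma_additive.

End spectral_measure_is_measure.

(* A is the integral of f (bounded and measurable) against E, i.e. the unique
   bounded operator with <A u, u> = \int f(x) d<E(x) u, u> for every u. *)
Definition is_pvm_integral (f : X -> R[i]) (A : L2 -> L2) : Prop :=
  [/\ linear A,
      exists M : R, forall u, L2norm (A u) <= M * L2norm u
    & forall u, dot (A u) u = cintegral (spectral_measure u) setT f].

End projection_valued_measure.
Arguments pvm {d T R} mu {dX} X.

Section koopman.
Context {d} {T : measurableType d} {R : realType}.
Variable mu : {measure set T -> \bar R}.
Local Notation L2 := (L2 mu).

Definition measure_preserving (F : T -> T) : Prop :=
  measurable_fun setT F /\
  forall A, measurable A -> mu (F @^-1` A) = mu A.

Definition invertible_mod_null (F : T -> T) : Prop :=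
  exists G : T -> T, [/\ measurable_fun setT G,
    {ae mu, forall x, G (F x) = x} & {ae mu, forall x, F (G x) = x}].

(* The class of f if f is square-integrable, and 0 otherwise. *)
Definition L2class (f : T -> R[i]) : L2 := \pi_L2 (insubd (0 : L2fun mu) f).

Definition koopman (F : T -> T) (u : L2) : L2 := L2class (u \o F).

Lemma Lfun2_comp (F : T -> T) (h : T -> R) :
  measure_preserving F -> h \in Lfun mu 2%:E -> h \o F \in Lfun mu 2%:E.
Proof.
move=> [mF pF]; rewrite !inE /= => /andP[]; rewrite !inE /= => mh hL.
apply/andP; split; rewrite inE /=; first exact: measurableT_comp.
move: hL; rewrite /finite_norm unlock /=.
suff -> : (\int[mu]_x (`|(h (F x))%:E| `^ 2) = \int[mu]_x (`|(h x)%:E| `^ 2))%E by [].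
pose g (x : T) : \bar R := (`|(h x)%:E| `^ 2)%E.
have mg : measurable_fun setT g.
  apply: (measurableT_comp (measurable_poweR 2)).
  by apply: measurableT_comp => //; exact/measurable_EFinP.
have := @ge0_integral_pushforward _ _ _ _ R F mF mu setT _ measurableT mg.
rewrite preimage_setT /= => <-; last by move=> x _; exact: poweR_ge0.
by apply: eq_measure_integral => A mA _; rewrite -pF.
Qed.

Lemma isL2_comp (F : T -> T) (f : T -> R[i]) :
  measure_preserving F -> f \in isL2 mu -> f \o F \in isL2 mu.
Proof.
move=> hF; rewrite !inE => /andP[fr fi]; apply/andP; split.
  exact: (Lfun2_comp hF fr).
exact: (Lfun2_comp hF fi).
Qed.

(* [koopman] does not depend on the choice of a representative. *)
Lemma koopmanE (F : T -> T) (f : L2fun mu) : measure_preserving F ->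
  {ae mu, forall x, koopman F (\pi_L2 f) x = f (F x)}.
Proof.
move=> hF; set u : L2 := \pi_L2 f.
have uF : u \o F \in isL2 mu by apply: isL2_comp => //; exact: valP (u : L2fun mu).
have E1 := L2reprK (insubd (0 : L2fun mu) (u \o F)).
have [N [mN N0 hN]] := L2reprK f.
have E2 : {ae mu, forall x, u (F x) = f (F x)}.
  exists (F @^-1` N); split.
  - by rewrite -[X in measurable X]setTI; exact: hF.1.
  - by rewrite hF.2.
  - by move=> x /= ux; exact: hN.
apply: filterS2 E1 E2 => x /= h1 h2.
by rewrite -h2 [LHS]h1 /insubd insubT.
Qed.

End koopman.

Section periodic_interval.
Context {R : realType}.

Definition period : set R := `]- pi, pi]%classic.

Lemma period_neq0 : period !=set0.
Proof.
by exists pi; rewrite /period /= in_itv /= lexx andbT gtrN ?pi_gt0.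
Qed.

(* The periodic interval, each angle being represented by its value in
   (-pi, pi]; a function on it is a 2pi-periodic function on R. *)
Definition per := borel_subset period_neq0.
HB.instance Definition _ := Measurable.on per.

Definition angle (phi : per) : R := set_val (phi : set_type period).

(* The image of [theta0 - c, theta0 + c] in the periodic interval. *)
Definition per_arc (theta0 c : R) : set per :=
  [set phi | exists k : int,
     angle phi + k%:~R * (2 * pi) \in `[theta0 - c, theta0 + c]].

Record order_kernel (m : nat) (K : R -> R -> R[i]) : Prop := OrderKernel {
  kernel_periodic : forall eps : R, 0 < eps <= 1 ->
    forall theta : R, K eps (theta + 2 * pi) = K eps theta ;
  kernel_continuous_Re : forall eps : R, 0 < eps <= 1 ->
    continuous (fun theta : R => Re (K eps theta)) ;
  kernel_continuous_Im : forall eps : R, 0 < eps <= 1 ->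
    continuous (fun theta : R => Im (K eps theta)) ;
  kernel_mass : forall eps : R, 0 < eps <= 1 ->
    cintegral lebesgue_measure `[- pi, pi] (K eps) = 1 ;
  kernel_approx : exists CK : R,
    (forall eps : R, 0 < eps <= 1 -> forall n : nat, (0 < n < m)%N ->
      normc (cintegral lebesgue_measure `[- pi, pi]
               (fun theta : R => K eps (- theta) * expi (n%:R * theta)) - 1)
        <= CK * eps ^+ m * ln (1 + eps^-1)) /\
    (forall eps : R, 0 < eps <= 1 -> forall theta : R, theta \in `[- pi, pi] ->
      normc (K eps theta) <= CK * eps ^+ m * (eps + `|theta|) ^- m.+1)
}.

End periodic_interval.
Arguments per R : clear implicits.

Section spectral_calculus.
Context {d} {T : measurableType d} {R : realType}.
Variables (mu : {measure set T -> \bar R}) (E : pvm mu (per R)).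
Local Notation L2 := (L2 mu).

Definition is_spectral_resolution (U : L2 -> L2) : Prop :=
  is_pvm_integral E (fun phi => expi (angle phi)) U.

(* A theta is the operator [k * E](theta). *)
Definition is_convolution (k : R -> R[i]) (A : R -> L2 -> L2) : Prop :=
  forall theta, is_pvm_integral E (fun phi => k (theta - angle phi)) (A theta).

End spectral_calculus.

(* Main.v *)
Require Import Defs.
From mathcomp Require Import all_boot all_order all_algebra.
From mathcomp Require Import all_classical all_reals all_analysis.
From mathcomp Require Import measurable_realfun complex ring lra.

(** Write xi for the spectral measure of g and f for the function
    K eps (theta0 - .) of the angle. The multiplicative functional calculus
    turns both norms into integrals against xi:
      |g_eps|^2 = \int |f|^2 dxi,
      |(U - e^(i theta0)) g_eps|^2 = \int |e^(i phi) - e^(i theta0)|^2 |f|^2 dxi.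

    The residual (second line) tends to 0. Let t be the distance from theta0 to
    phi on the circle, so that |e^(i phi) - e^(i theta0)| <= t. The decay
    |f| <= CK eps^m / (eps + t)^(m + 1) with m > 0 gives t |f| <= CK and
    t^2 |f| <= CK eps ([kernel_bound]): the integrand is bounded uniformly in
    eps and tends to 0 pointwise, also at t = 0 where it vanishes. As xi is
    finite, dominated convergence applies ([residual_cvg0]).

    The mass (first line) stays away from 0. On the arc of radius
    eta eps / 2 around theta0 the first hypothesis gives |f| >= b / eps, and by
    the second one this arc has measure at least a (eta eps / 2)^2; the powers
    of eps cancel ([filtered_mass_ge]).

    An operator integral is given by its quadratic form only, so the functional
    calculus has to be derived. The key is [pvm_integral_density]: if the complex
    measure <E(.) w, v> has density h with respect to xi_u, then
    <A w, v> = \int f h dxi_u for the integral A of f. By polarization this is a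
    statement on finite differences of positive measures, which reduces to
    indicator functions ([Rintegral_density]). To use it one needs such
    densities, and they are provided by [dot_pvm_integral_pvm]: for the integral
    B of g, <B u, E(S) u> = \int_S g dxi_u. It holds because the unitary
    c E(S) + E(~S), |c| = 1, leaves the spectral measure of u invariant, hence
    also the quadratic form of B at u, so that B has no off-diagonal terms
    between E(S) u and E(~S) u. *)

Set Implicit Arguments.
Unset Strict Implicit.
Unset Printing Implicit Defensive.
Import Order.TTheory GRing.Theory Num.Theory.
Import numFieldNormedType.Exports.

Local Open Scope classical_set_scope.
Local Open Scope ring_scope.

Local Notation Re := complex.Re.
Local Notation Im := complex.Im.

(** * Bounded measurable functions and finite measures *)

Section bounded_measurable.
Context {dX} {X : measurableType dX} {R : realType}.
Implicit Types (p q : X -> R) (mu nu : {measure set X -> \bar R}).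

Definition bounded_measurable p :=
  measurable_fun setT p /\ exists M : R, forall x, `|p x| <= M.

Lemma bounded_measurable_cst (a : R) : bounded_measurable (fun=> a).
Proof. by split; [exact: measurable_cst | exists `|a|]. Qed.

Lemma bounded_measurableD p q : bounded_measurable p -> bounded_measurable q ->
  bounded_measurable (fun x => p x + q x).
Proof.
move=> [mp [M pM]] [mq [N qN]]; split; first exact: measurable_funD.
by exists (M + N) => x; rewrite (le_trans (ler_normD _ _)) // lerD.
Qed.

Lemma bounded_measurableM p q : bounded_measurable p -> bounded_measurable q ->
  bounded_measurable (fun x => p x * q x).
Proof.
move=> [mp [M pM]] [mq [N qN]]; split; first exact: measurable_funM.
by exists (M * N) => x; rewrite normrM ler_pM.
Qed.

Lemma bounded_measurableZ a p : bounded_measurable p ->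
  bounded_measurable (fun x => a * p x).
Proof. exact/bounded_measurableM/bounded_measurable_cst. Qed.

Lemma bounded_measurableB p q : bounded_measurable p -> bounded_measurable q ->
  bounded_measurable (fun x => p x - q x).
Proof.
move=> bp bq; have := bounded_measurableD bp (bounded_measurableZ (-1) bq).
by congr bounded_measurable; apply/funext => x; rewrite mulN1r.
Qed.

Lemma bounded_measurable_indic (S : set X) : measurable S ->
  bounded_measurable (\1_S : X -> R).
Proof.
move=> mS; split; first exact: measurable_indic.
by exists 1 => x; rewrite indicE; case: (_ \in _); rewrite ?normr0 ?normr1.
Qed.

Lemma bounded_measurable_integrable mu p : (mu setT < +oo)%E ->
  bounded_measurable p -> mu.-integrable setT (EFin \o p).
Proof.
move=> fmu [mp [M pM]]; apply: measurable_bounded_integrable => //.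
exists M; split; first exact: num_real.
by move=> N MN x _; apply: le_trans (pM x) (ltW MN).
Qed.

Lemma Rintegral_norm_le mu p (M : R) : (mu setT < +oo)%E ->
  bounded_measurable p -> (forall x, `|p x| <= M) ->
  `|\int[mu]_x p x| <= M * fine (mu setT).
Proof.
move=> fmu bp pM.
have ip := bounded_measurable_integrable fmu bp.
apply: (le_trans (le_normr_Rintegral measurableT ip)).
rewrite -Rintegral_cst //; apply: le_Rintegral => //.
  exact: (integrable_norm ip).
by apply: bounded_measurable_integrable => //; exact: bounded_measurable_cst.
Qed.

(** If |p| <= M, subtracting M / 2 where p >= 0 and adding M / 2 elsewhere
    leaves a function bounded by M / 2 with the same image under L. Iterating,
    |L p| is at most C M / 2^n for every n. *)
Lemma bounded_functional_eq0 (L : (X -> R) -> R) (C : R) :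
  (forall p q a, bounded_measurable p -> bounded_measurable q ->
     L (fun x => p x + a * q x) = L p + a * L q) ->
  (forall p M, bounded_measurable p -> (forall x, `|p x| <= M) ->
     `|L p| <= C * M) ->
  (forall S, measurable S -> L (\1_S) = 0) ->
  forall p, bounded_measurable p -> L p = 0.
Proof.
move=> linL bL L1 p bp; have [_ [M0 pM0]] := bp.
have halve n : forall q M, bounded_measurable q -> (forall x, `|q x| <= M) ->
    `|L q| <= C * (M / 2 ^+ n).
  elim: n => [|n ih] q M bq qM; first by rewrite expr0 divr1; exact: bL.
  pose S := [set x | 0 <= q x].
  have mS : measurable S.
    rewrite (_ : S = setT `&` q @^-1` `[0, +oo[); first exact: bq.1.
    by rewrite setTI; apply/seteqP; split => x /=; rewrite in_itv /= andbT.
  have bS := bounded_measurable_indic mS.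
  have bT := bounded_measurable_indic (@measurableT _ X).
  have bq' : bounded_measurable (fun x => q x + M / 2 * \1_setT x).
    by apply: bounded_measurableD => //; exact: bounded_measurableZ.
  have := ih (fun x => (q x + M / 2 * \1_setT x) + (- M) * \1_S x) (M / 2).
  rewrite linL // linL // !L1 // !mulr0 !addr0.
  rewrite (_ : M / 2 ^+ n.+1 = M / 2 / 2 ^+ n); last first.
    by rewrite exprS invfM mulrA.
  apply; first by apply: bounded_measurableD => //; exact: bounded_measurableZ.
  move=> x; have := qM x.
  rewrite !indicE in_setT mulr1 /S ler_norml => /andP[h1 h2].
  case: (boolP (x \in _)) => [|/negP]; rewrite inE /= => h3.
    by rewrite ler_norml; apply/andP; split; lra.
  move/negP: h3; rewrite -ltNge => h3.
  by rewrite ler_norml; apply/andP; split; lra.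
apply/eqP/contraT => Lp0.
have Lp : 0 < `|L p| by rewrite normr_gt0.
pose t := C * M0 / `|L p|.
have t0 : 0 <= t by rewrite divr_ge0 // (le_trans _ (bL _ _ bp pM0)).
have h : t < 2 ^+ Num.bound t.
  rewrite (lt_le_trans (archi_boundP t0)) // -natrX ler_nat ltnW //.
  exact: ltn_expl.
have := halve (Num.bound t) p M0 bp pM0.
rewrite mulrA ler_pdivlMr ?exprn_gt0 // leNgt => /negP; case.
by rewrite -ltr_pdivrMl // mulrC.
Qed.

(** A change of density for the signed measure [mu1 - mu2]: both sides are
    bounded linear functionals of p, and they agree on indicators. *)
Lemma Rintegral_density mu1 mu2 nu (h : X -> R) :
  (mu1 setT < +oo)%E -> (mu2 setT < +oo)%E -> (nu setT < +oo)%E ->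
  bounded_measurable h ->
  (forall S, measurable S ->
     fine (mu1 S) - fine (mu2 S) = \int[nu]_(x in S) h x) ->
  forall p, bounded_measurable p ->
    \int[mu1]_x p x - \int[mu2]_x p x = \int[nu]_x (p x * h x).
Proof.
move=> f1 f2 f3 bh dens p bp; apply/eqP; rewrite -subr_eq0; apply/eqP.
have [_ [H hH]] := bh.
have lin mu q r a : (mu setT < +oo)%E ->
    bounded_measurable q -> bounded_measurable r ->
    \int[mu]_x (q x + a * r x) = \int[mu]_x q x + a * \int[mu]_x r x.
  move=> fm bq br; rewrite RintegralD ?RintegralZl //;
    apply: bounded_measurable_integrable => //; exact: bounded_measurableZ.
apply: (@bounded_functional_eq0
  (fun q => \int[mu1]_x q x - \int[mu2]_x q x - \int[nu]_x (q x * h x))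
  (fine (mu1 setT) + fine (mu2 setT) + H * fine (nu setT))) bp.
- move=> q r a bq br.
  rewrite lin // lin //.
  under [\int[nu]_x _]eq_Rintegral do rewrite mulrDl -mulrA.
  rewrite lin //; [by ring|exact: bounded_measurableM..].
- move=> q M bq qM.
  have b1 := Rintegral_norm_le f1 bq qM.
  have b2 := Rintegral_norm_le f2 bq qM.
  have b3 : `|\int[nu]_x (q x * h x)| <= M * H * fine (nu setT).
    apply: Rintegral_norm_le => //; first exact: bounded_measurableM.
    by move=> x; rewrite normrM ler_pM.
  have -> : (fine (mu1 setT) + fine (mu2 setT) + H * fine (nu setT)) * M =
    M * fine (mu1 setT) + M * fine (mu2 setT) + M * H * fine (nu setT) by ring.
  rewrite (le_trans (ler_normB _ _)) // lerD //.
  by rewrite (le_trans (ler_normB _ _)) // lerD.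
- move=> S mS.
  have ind mu : \int[mu]_x \1_S x = fine (mu S).
    by rewrite /Rintegral integral_indic // setIT.
  rewrite !ind dens // Rintegral_mkcond; apply/eqP; rewrite subr_eq0; apply/eqP.
  apply: eq_Rintegral => x _; rewrite /patch indicE.
  by case: (x \in S); rewrite ?mul1r ?mul0r.
Qed.

End bounded_measurable.

Lemma normc_ge0 {R : realType} (z : R[i]) : 0 <= normc z.
Proof. by case: z => a b; exact: sqrtr_ge0. Qed.

Lemma normc_sqr {R : realType} (z : R[i]) :
  normc z ^+ 2 = Re z ^+ 2 + Im z ^+ 2.
Proof. by case: z => a b /=; rewrite sqr_sqrtr // addr_ge0 ?sqr_ge0. Qed.

Section bounded_measurablec.
Context {dX} {X : measurableType dX} {R : realType}.
Implicit Types (f g : X -> R[i]).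

Definition bounded_measurablec f :=
  bounded_measurable (fun x => Re (f x)) /\
  bounded_measurable (fun x => Im (f x)).

Lemma bounded_measurablecP f :
  measurable_fun setT (fun x => Re (f x)) ->
  measurable_fun setT (fun x => Im (f x)) ->
  (exists M : R, forall x, normc (f x) <= M) -> bounded_measurablec f.
Proof.
move=> mr mi [M fM]; split; split => //; exists M => x;
  apply: le_trans (fM x); rewrite -(ler_pXn2r (n := 2)) ?nnegrE ?normc_ge0 //
    normc_sqr real_normK ?num_real // ?lerDl ?lerDr sqr_ge0 //.
Qed.

Lemma bounded_measurablec_cst (c : R[i]) : bounded_measurablec (fun=> c).
Proof. by split; exact: bounded_measurable_cst. Qed.

Lemma bounded_measurablecB f g :
  bounded_measurablec f -> bounded_measurablec g ->
  bounded_measurablec (fun x => f x - g x).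
Proof.
move=> [f1 f2] [g1 g2]; split.
  have := bounded_measurableB f1 g1.
  by congr bounded_measurable; apply/funext => x; case: (f x) (g x) => [? ?] [].
have := bounded_measurableB f2 g2.
by congr bounded_measurable; apply/funext => x; case: (f x) (g x) => [? ?] [].
Qed.

Lemma bounded_measurablecM f g :
  bounded_measurablec f -> bounded_measurablec g ->
  bounded_measurablec (fun x => f x * g x).
Proof.
move=> [f1 f2] [g1 g2]; split.
  have := bounded_measurableB (bounded_measurableM f1 g1)
                              (bounded_measurableM f2 g2).
  by congr bounded_measurable; apply/funext => x; case: (f x) (g x) => [? ?] [].
have := bounded_measurableD (bounded_measurableM f1 g2)
                            (bounded_measurableM f2 g1).
by congr bounded_measurable; apply/funext => x; case: (f x) (g x) => [? ?] [].
Qed.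

Lemma bounded_measurable_normc_sqr f : bounded_measurablec f ->
  bounded_measurable (fun x => normc (f x) ^+ 2).
Proof.
move=> [f1 f2]; have := bounded_measurableD (bounded_measurableM f1 f1)
                                            (bounded_measurableM f2 f2).
by congr bounded_measurable; apply/funext => x; rewrite normc_sqr !expr2.
Qed.

Lemma eq_measure_cintegral (m1 m2 : {measure set X -> \bar R}) f :
  (forall S, measurable S -> m1 S = m2 S) ->
  cintegral m1 setT f = cintegral m2 setT f.
Proof.
move=> m12.
have eqR (p : X -> R) : \int[m1]_x p x = \int[m2]_x p x.
  by congr fine; apply: eq_measure_integral => S mS _; exact: m12.
by rewrite /cintegral !eqR.
Qed.

End bounded_measurablec.

(** * The functional calculus of a projection-valued measure *)

Section functional_calculus.
Local Open Scope complex_scope.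
Context {d} {T : measurableType d} {R : realType}.
Variable mu : {measure set T -> \bar R}.
Context {dX} {X : measurableType dX}.
Local Notation L2 := (L2 mu).
Local Notation C := R[i].
Implicit Types (u v w : L2) (A B : L2 -> L2) (S : set X) (c : C).
Implicit Types (f g h : X -> C).

Lemma dot_DZ A w c v : linear A ->
  dot (A (w + c *: v)) (w + c *: v) =
  dot (A w) w + c^* * dot (A w) v + c * dot (A v) w + c * c^* * dot (A v) v.
Proof.
move=> lA; have -> : A (w + c *: v) = A w + c *: A v.
  by rewrite addrC lA addrC.
by rewrite dotDl !dotDr !dotZl !dotZr; ring.
Qed.

(** The vectors are w + i^k v, k = 0, 2, 1, 3. They are quantified
    existentially because only their independence of A matters: the same four
    quadratic forms serve an operator and the projections of E. *)
Lemma polarization w v : exists w1 w2 w3 w4, forall A, linear A ->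
  dot (A w) v = (4^-1)%:C *
    (dot (A w1) w1 - dot (A w2) w2 + 'i * (dot (A w3) w3 - dot (A w4) w4)).
Proof.
exists (w + 1 *: v), (w + -1 *: v), (w + 'i *: v), (w + (- 'i) *: v).
move=> A lA; rewrite !dot_DZ //.
case: (dot (A w) w) (dot (A w) v) (dot (A v) w) (dot (A v) v).
move=> a1 a2 [b1 b2] [c1 c2] [d1 d2].
by apply/eqP; rewrite eq_complex /=; apply/andP; split; apply/eqP; field.
Qed.

Variable E : pvm mu X.
Local Notation xi := (spectral_measure E).

Lemma spectral_measureE u S : measurable S -> xi u S = (Re (dot (E S u) u))%:E.
Proof. by rewrite /spectral_measure => mS; case: ifPn => // /asboolP. Qed.

Lemma spectral_measure_fin u : (xi u setT < +oo)%E.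
Proof. by rewrite spectral_measureE // ltry. Qed.

Lemma dot_pvm_real u S : measurable S ->
  dot (E S u) u = (fine (xi u S))%:C.
Proof.
move=> mS; rewrite spectral_measureE //.
have : dot (E S u) u = (dot (E S u) u)^* by rewrite -dotC pvm_selfadjoint.
move: (dot _ _) => [a b] /= /eqP; rewrite eq_complex /= => /andP[_ /eqP h].
by congr (_ +i* _); lra.
Qed.

Lemma bounded_measurablec_integrable u f : bounded_measurablec f ->
  (xi u).-integrable setT (EFin \o (fun x => Re (f x))) /\
  (xi u).-integrable setT (EFin \o (fun x => Im (f x))).
Proof.
by move=> [bf1 bf2]; split; apply: bounded_measurable_integrable => //;
  exact: spectral_measure_fin.
Qed.

(** Keeping only linearity and the quadratic form makes differences and
    composites immediate, with no operator norm to estimate. *)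
Definition pvm_integral f A :=
  linear A /\ forall u, dot (A u) u = cintegral (xi u) setT f.

(** Polarizing both <E(S) w, v> and <A w, v> along the same four vectors wk
    turns the hypothesis into the densities 4 Re h and 4 Im h, with respect to
    xi_u, of the signed measures xi_w1 - xi_w2 and xi_w3 - xi_w4. The integrals
    of Re f and Im f against these four measures are all that <A w, v> needs. *)
Lemma pvm_integral_density f h A u v w :
  bounded_measurablec f -> bounded_measurablec h -> pvm_integral f A ->
  (forall S, measurable S -> dot (E S w) v = cintegral (xi u) S h) ->
  dot (A w) v = cintegral (xi u) setT (fun x => f x * h x).
Proof.
move=> [bf1 bf2] [bh1 bh2] [lA iA] dens.
have [w1 [w2 [w3 [w4 pol]]]] := polarization w v.
have fin := spectral_measure_fin.
pose k : R := 4^-1.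
have k4 : k^-1 = 4 by rewrite /k invrK.
have intk S (p : X -> R) : measurable S -> bounded_measurable p ->
    \int[xi u]_(x in S) (k^-1 * p x) = k^-1 * \int[xi u]_(x in S) p x.
  move=> mS bp; rewrite RintegralZl //.
  apply: (@integrableS _ _ _ _ setT) => //.
  by apply: bounded_measurable_integrable => //; exact: fin.
have densE S : measurable S ->
    fine (xi w1 S) - fine (xi w2 S) =
      \int[xi u]_(x in S) (k^-1 * Re (h x)) /\
    fine (xi w3 S) - fine (xi w4 S) =
      \int[xi u]_(x in S) (k^-1 * Im (h x)).
  move=> mS; rewrite !intk //.
  have := dens S mS; rewrite (pol _ (pvm_linear E mS)) !dot_pvm_real //.
  rewrite /cintegral -/k.
  move: (fine _) (fine _) (fine _) (fine _) => a1 a2 a3 a4.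
  by move=> [<- <-]; rewrite k4 /k; split; field.
have dre p : bounded_measurable p ->
    \int[xi w1]_x p x - \int[xi w2]_x p x =
    \int[xi u]_x (p x * (k^-1 * Re (h x))).
  by apply: Rintegral_density;
    [exact: fin..|exact: bounded_measurableZ|move=> S /densE[]].
have dim p : bounded_measurable p ->
    \int[xi w3]_x p x - \int[xi w4]_x p x =
    \int[xi u]_x (p x * (k^-1 * Im (h x))).
  by apply: Rintegral_density;
    [exact: fin..|exact: bounded_measurableZ|move=> S /densE[]].
have pull p q : bounded_measurable p -> bounded_measurable q ->
    \int[xi u]_x (p x * (k^-1 * q x)) = k^-1 * \int[xi u]_x (p x * q x).
  move=> bp bq; rewrite -intk //; last exact: bounded_measurableM.
  by apply: eq_Rintegral => x _; ring.
have int p q : bounded_measurable p -> bounded_measurable q ->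
    (xi u).-integrable setT (EFin \o (fun x => p x * q x)).
  move=> bp bq; apply: bounded_measurable_integrable; first exact: fin.
  exact: bounded_measurableM.
have eRe : \int[xi u]_x Re (f x * h x) =
    \int[xi u]_x (Re (f x) * Re (h x)) - \int[xi u]_x (Im (f x) * Im (h x)).
  rewrite -RintegralB //; [|exact: int..].
  by apply: eq_Rintegral => x _; case: (f x) (h x) => [? ?] [].
have eIm : \int[xi u]_x Im (f x * h x) =
    \int[xi u]_x (Re (f x) * Im (h x)) + \int[xi u]_x (Im (f x) * Re (h x)).
  rewrite -RintegralD //; [|exact: int..].
  by apply: eq_Rintegral => x _; case: (f x) (h x) => [? ?] [].
rewrite (pol _ lA) !iA /cintegral -/k eRe eIm.
have := dim _ bf2; have := dim _ bf1; have := dre _ bf2; have := dre _ bf1.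
rewrite (pull _ _ bf1 bh1) (pull _ _ bf1 bh2).
rewrite (pull _ _ bf2 bh1) (pull _ _ bf2 bh2).
(* An opaque name for the integral: otherwise the ring tactics unfold it when
   they compare integrals against different measures. *)
have [J JE] : exists J : L2 -> (X -> R) -> R,
    forall x p, \int[xi x]_y p y = J x p.
  by exists (fun x p => \int[xi x]_y p y).
rewrite !JE => e1 e2 e3 e4.
apply/eqP; rewrite eq_complex /=; apply/andP; split; apply/eqP.
- transitivity (k * ((J w1 (fun x => Re (f x)) - J w2 (fun x => Re (f x))) -
    (J w3 (fun x => Im (f x)) - J w4 (fun x => Im (f x))))); first by ring.
  by rewrite e1 e4 k4 /k; field.
- transitivity (k * ((J w1 (fun x => Im (f x)) - J w2 (fun x => Im (f x))) +
    (J w3 (fun x => Re (f x)) - J w4 (fun x => Re (f x))))); first by ring.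
  by rewrite e2 e3 k4 /k; field.
Qed.

Lemma dot_pvm_cut u S S' : measurable S -> measurable S' ->
  [/\ dot (E S' u) (E S u) = dot (E (S' `&` S) u) u,
      dot (E S' (E S u)) u = dot (E (S' `&` S) u) u &
      dot (E S' (E S u)) (E S u) = dot (E (S' `&` S) u) u].
Proof.
move=> mS mS'; split.
- by rewrite -pvm_selfadjoint // -pvmI // setIC.
- by rewrite -pvmI.
- rewrite -pvm_selfadjoint // -!pvmI //; last exact: measurableI.
  by rewrite setIAC setIid setIC.
Qed.

(** The condition on c says that |1 + c| = 1, so that u + c E(S) u is the image
    of u under the unitary (1 + c) E(S) + E(~S), which commutes with E. *)
Lemma spectral_measure_rotate u S c : measurable S -> c + c^* + c * c^* = 0 ->
  forall S', measurable S' -> xi (u + c *: E S u) S' = xi u S'.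
Proof.
move=> mS c0 S' mS'; rewrite !spectral_measureE // dot_DZ; last first.
  exact: pvm_linear.
have [-> -> ->] := dot_pvm_cut u mS mS'.
by rewrite -!addrA -!mulrDl !addrA (addrC c^*) c0 mul0r addr0.
Qed.

(** By rotation invariance, <B u, u> = <B w, w> for w = u + c E(S) u. The values
    c = -2 and c = -1 + i (that is, 1 + c = -1 and 1 + c = i) give two linear
    equations for <B u, E(S) u>, <B E(S) u, u> and <B E(S) u, E(S) u>, which
    force the three to be equal. *)
Lemma dot_pvm_integral_compress g B u S : measurable S -> pvm_integral g B ->
  dot (B u) (E S u) = dot (B (E S u)) (E S u).
Proof.
move=> mS [lB iB].
have rot c : c + c^* + c * c^* = 0 ->
    dot (B (u + c *: E S u)) (u + c *: E S u) = dot (B u) u.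
  move=> c0; rewrite !iB; apply: eq_measure_cintegral.
  exact: spectral_measure_rotate.
have /rot : (-2%:R +i* 0 : C) + (-2%:R +i* 0)^* +
    (-2%:R +i* 0) * (-2%:R +i* 0)^* = 0.
  by apply/eqP; rewrite eq_complex /=; apply/andP; split; apply/eqP; ring.
have /rot : (-1 +i* 1 : C) + (-1 +i* 1)^* + (-1 +i* 1) * (-1 +i* 1)^* = 0.
  by apply/eqP; rewrite eq_complex /=; apply/andP; split; apply/eqP; ring.
rewrite !dot_DZ //.
case: (dot (B u) u) (dot (B u) (E S u)) (dot (B (E S u)) u)
  (dot (B (E S u)) (E S u)) => a1 a2 [x1 x2] [y1 y2] [z1 z2].
move=> /eqP; rewrite eq_complex /= => /andP[/eqP e1 /eqP e2].
move=> /eqP; rewrite eq_complex /= => /andP[/eqP e3 /eqP e4].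
by congr (_ +i* _); lra.
Qed.

Lemma Rintegral_spectral_measure_cut u S (p : X -> R) : measurable S ->
  bounded_measurable p -> \int[xi (E S u)]_x p x = \int[xi u]_(x in S) p x.
Proof.
move=> mS bp.
have := Rintegral_density (mu1 := xi (E S u)) (mu2 := mzero) (nu := xi u)
  (h := \1_S) _ _ _ _ _ bp.
rewrite [X in _ - X = _]/Rintegral integral_measure_zero subr0 => ->.
- rewrite [RHS]Rintegral_mkcond; apply: eq_Rintegral => x _.
  by rewrite /patch indicE; case: (x \in S); rewrite ?mulr1 ?mulr0.
- exact: spectral_measure_fin.
- by rewrite /mzero ltry.
- exact: spectral_measure_fin.
- exact: bounded_measurable_indic.
- move=> S' mS'; rewrite /mzero /= subr0.
  have -> : \int[xi u]_(x in S') \1_S x = fine (xi u (S `&` S')).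
    by rewrite /Rintegral integral_indic.
  rewrite spectral_measureE // spectral_measureE; last exact: measurableI.
  by have [_ _ ->] := dot_pvm_cut u mS mS'; rewrite setIC.
Qed.

Lemma dot_pvm_integral_pvm g B u S : measurable S -> bounded_measurablec g ->
  pvm_integral g B -> dot (B u) (E S u) = cintegral (xi u) S g.
Proof.
move=> mS [bg1 bg2] iB; rewrite (dot_pvm_integral_compress _ mS iB) iB.2.
by rewrite /cintegral (Rintegral_spectral_measure_cut u mS bg1)
  (Rintegral_spectral_measure_cut u mS bg2).
Qed.

Lemma pvm_integral_cst c : pvm_integral (fun=> c) (fun u => c *: u).
Proof.
split=> [a u v|u]; first by rewrite scalerDr !scalerA mulrC.
rewrite dotZl -{1}(pvmT E u) dot_pvm_real // /cintegral !Rintegral_cst //.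
case: c => a b; apply/eqP; rewrite eq_complex /=.
by apply/andP; split; apply/eqP; ring.
Qed.

Lemma pvm_integralB f g A B : bounded_measurablec f -> bounded_measurablec g ->
  pvm_integral f A -> pvm_integral g B ->
  pvm_integral (fun x => f x - g x) (fun u => A u - B u).
Proof.
move=> bf bg [lA iA] [lB iB]; split=> [a u v|u].
  by rewrite lA lB scalerBr addrACA opprD.
have [rf mf] := bounded_measurablec_integrable u bf.
have [rg mg] := bounded_measurablec_integrable u bg.
rewrite dotDl -scaleN1r dotZl mulN1r iA iB.
apply/eqP; rewrite eq_complex /=.
rewrite -(RintegralB measurableT rf rg) -(RintegralB measurableT mf mg).
by apply/andP; split; apply/eqP; apply: eq_Rintegral => x _;
  case: (f x) (g x) => [? ?] [].
Qed.

(** The density lemma applies to <A (B u), u>, since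
    <E(S) B u, u> = <B u, E(S) u> has density g. *)
Lemma pvm_integralM f g A B : bounded_measurablec f -> bounded_measurablec g ->
  pvm_integral f A -> pvm_integral g B ->
  pvm_integral (fun x => f x * g x) (A \o B).
Proof.
move=> bf bg iA iB; split.
  by move=> a v w /=; rewrite iB.1 iA.1.
move=> u; apply: (pvm_integral_density bf bg iA) => S mS.
by rewrite pvm_selfadjoint //; exact: dot_pvm_integral_pvm.
Qed.

(** The density lemma applies to <A u, A u>, since <E(S) u, A u>, the conjugate
    of <A u, E(S) u>, has density the conjugate of f; no adjoint of A has to be
    constructed. *)
Lemma pvm_integral_norm f A u : bounded_measurablec f -> pvm_integral f A ->
  Re (dot (A u) (A u)) = \int[xi u]_x (normc (f x) ^+ 2).
Proof.
move=> bf iA.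
have bfc : bounded_measurablec (fun x => (f x)^*).
  have [bf1 bf2] := bf; split.
    move: bf1; congr bounded_measurable.
    by apply/funext => x; case: (f x).
  have := bounded_measurableZ (-1) bf2; congr bounded_measurable.
  by apply/funext => x; rewrite mulN1r; case: (f x).
have -> := pvm_integral_density (u := u) (v := A u) (w := u) bf bfc iA.
  apply: eq_Rintegral => x _; case: (f x) => a b /=.
  by rewrite sqr_sqrtr ?addr_ge0 ?sqr_ge0 // mulrN opprK !expr2.
move=> S mS; rewrite dotC (dot_pvm_integral_pvm _ mS bf iA).
apply/eqP; rewrite eq_complex /=; apply/andP; split; apply/eqP.
  by apply: eq_Rintegral => x _; case: (f x).
rewrite -mulN1r -RintegralZl //.
  by apply: eq_Rintegral => x _; rewrite mulN1r; case: (f x).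
by apply: integrableS (bounded_measurablec_integrable u bf).2.
Qed.

End functional_calculus.

(** * Angles on the circle *)

Section angles.
Context {R : realType}.
Implicit Types (t a b theta : R) (phi : per R).

Lemma normr_sin_le t : `|sin t| <= `|t|.
Proof.
wlog t0 : t / 0 <= t => [h|].
  have [/h //|/ltW t0] := leP 0 t.
  by rewrite -normrN -sinN -(normrN t) h // oppr_ge0.
have [c _] := @MVT_segment R sin cos 0 t t0 (fun x _ => is_derive_sin x)
  (continuous_subspaceT (@continuous_sin R)).
rewrite sin0 !subr0 => ->; rewrite normrM ler_piMl //.
by rewrite ler_norml cos_geN1 cos_le1.
Qed.

(** The squared chord is 2 - 2 cos (a - b) = 4 sin^2 ((a - b) / 2). *)
Lemma normc_expiB_le a b : normc (expi a - expi b) <= `|a - b|.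
Proof.
rewrite -(ler_pXn2r (n := 2)) ?nnegrE ?normc_ge0 // normc_sqr /=.
rewrite real_normK ?num_real //.
have -> : (cos a - cos b) ^+ 2 + (sin a - sin b) ^+ 2 = 2 - 2 * cos (a - b).
  have := cos2Dsin2 a; have := cos2Dsin2 b; rewrite cosB; nra.
have -> : a - b = ((a - b) / 2) *+ 2 by rewrite -mulr_natr divfK.
move: (_ / 2) => t.
have h : sin t ^+ 2 <= t ^+ 2.
  rewrite -(real_normK (num_real (sin t))) -(real_normK (num_real t)).
  by rewrite ler_pXn2r ?nnegrE // normr_sin_le.
by rewrite cos_mulr2n cos2sin2 !mulr2n; lra.
Qed.

Lemma periodic_int (V : Type) (f : R -> V) (p : R) :
  (forall t, f (t + p) = f t) -> forall (k : int) t, f (t + k%:~R * p) = f t.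
Proof.
move=> fp; have fn (n : nat) t : f (t + n%:R * p) = f t.
  elim: n t => [|n ih] t; first by rewrite mul0r addr0.
  by rewrite mulrSr mulrDl mul1r addrA fp ih.
move=> k t; case: k => n; first exact: fn.
by rewrite NegzE mulrNz mulNr -[in RHS](subrK (n.+1%:R * p) t) fn.
Qed.

Lemma expi_periodic t : expi (t + 2 * pi) = expi t.
Proof. by rewrite /expi mulr_natl cosD2pi sinD2pi. Qed.

Lemma angle_itv phi : - pi < angle phi <= pi.
Proof.
by case: phi => x xp; have := set_mem xp; rewrite /period /= in_itv.
Qed.

Lemma reduce_angle theta phi : theta \in `[- pi, pi]%R ->
  exists t (k : int),
    t \in `[- pi, pi]%R /\ theta - angle phi = t + k%:~R * (2 * pi).
Proof.
rewrite in_itv /= => /andP[t1 t2]; have /andP[p1 p2] := angle_itv phi.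
have p0 := pi_gt0 R.
have [h|h] := leP (theta - angle phi) pi; last first.
  exists (theta - angle phi - 2 * pi), 1; split; last by rewrite mul1r; ring.
  by rewrite in_itv /=; apply/andP; split; lra.
have [h'|h'] := leP (- pi) (theta - angle phi); last first.
  exists (theta - angle phi + 2 * pi), (-1); split; last by rewrite mulN1r; ring.
  by rewrite in_itv /=; apply/andP; split; lra.
exists (theta - angle phi), 0; split; last by rewrite mul0r addr0.
by rewrite in_itv /= h h'.
Qed.

Lemma measurable_angle : measurable_fun setT (@angle R).
Proof.
apply: (measurability _ (RGenOpens.measurableE R)) => _ [_ [a [b ->] <-]].
rewrite setTI; apply: sub_sigma_algebra => /=.
by exists `]a, b[%classic => //; exact: interval_open.
Qed.

Lemma measurable_per_arc theta c : measurable (per_arc theta c).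
Proof.
rewrite (_ : per_arc _ _ = \bigcup_(k : int)
    (fun phi => angle phi + k%:~R * (2 * pi))
      @^-1` `[theta - c, theta + c]); last first.
  by apply/seteqP; split => [phi [k h]|phi [k _ h]]; exists k.
apply: countable_bigcupT_measurable; first exact: countableP.
move=> k; rewrite -[X in measurable X]setTI.
have : measurable_fun setT (fun phi : per R => angle phi + k%:~R * (2 * pi)).
  by apply: measurable_funD; [exact: measurable_angle|exact: measurable_cst].
by apply.
Qed.

Lemma bounded_measurable_expi :
  bounded_measurablec (fun phi : per R => expi (angle phi)).
Proof.
apply: bounded_measurablecP.
- have := continuous_measurable_fun (@continuous_cos R).
  by move=> /measurableT_comp; apply; exact: measurable_angle.
- have := continuous_measurable_fun (@continuous_sin R).
  by move=> /measurableT_comp; apply; exact: measurable_angle.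
- by exists 1 => phi; rewrite /= cos2Dsin2 sqrtr1.
Qed.

End angles.

(** * Limits of the residual and of the mass *)

Lemma limf_einf_gt0 (T : choiceType) (X : filteredType T) (R : realType)
    (f : X -> \bar R) (F : set_system X) : Filter F ->
  (0 < limf_einf f F)%E ->
  exists2 a : R, 0 < a & \forall x \near F, (a%:E <= f x)%E.
Proof.
move=> FF; rewrite limf_einfE => /ereal_sup_gt[_ [V FV <-]] V0.
have Vf x : V x -> (ereal_inf (f @` V) <= f x)%E.
  by move=> Vx; apply: ereal_inf_lbound; exists x.
case: (ereal_inf _) V0 Vf => [a| |] // V0 Vf.
  by exists a; [rewrite -lte_fin|exact: filterS FV].
by exists 1 => //; apply: filterS FV => x /Vf; apply: le_trans; rewrite leey.
Qed.

Lemma near_right0 (R : realType) (P : set R) : (\forall x \near 0^'+, P x) ->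
  exists2 r : R, 0 < r & forall x, 0 < x < r -> P x.
Proof.
move=> [r /= r0 h]; exists r => // x /andP[x0 xr]; apply: h => //=.
by rewrite sub0r normrN gtr0_norm.
Qed.

Section kernel_limits.
Context {R : realType} (m : nat) (K : R -> R -> R[i]).
Hypothesis m_gt0 : (0 < m)%N.
Hypothesis K_kernel : order_kernel m K.

Lemma kernel_periodic_int (eps : R) : 0 < eps <= 1 -> forall (k : int) t,
  K eps (t + k%:~R * (2 * pi)) = K eps t.
Proof. by move=> h; apply: periodic_int; exact: kernel_periodic K_kernel _ h. Qed.

(** Here t is the distance from theta0 to phi on the circle. Since m > 0, the
    decay of the kernel gives k (eps + t)^2 <= CK eps, and the four bounds
    follow because (eps + t)^2 dominates eps t, t^2 and eps^2, and z <= t k. *)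
Lemma kernel_bound : exists2 CK : R, 0 <= CK &
  forall theta0 (phi : per R), theta0 \in `[- pi, pi]%R ->
  exists2 t : R, 0 <= t &
  forall eps : R, 0 < eps <= 1 ->
  let k := normc (K eps (theta0 - angle phi)) in
  let z := normc ((expi (angle phi) - expi theta0) *
                  K eps (theta0 - angle phi)) in
  [/\ z <= t * k, z <= CK, t * z <= CK * eps & k <= CK / eps].
Proof.
have [CK [_ CKP]] := kernel_approx K_kernel.
have CK0 : 0 <= CK.
  have := CKP 1 _ 0 _; rewrite normr0 addr0 !expr1n mulr1 invr1 mulr1.
  move=> h; apply: le_trans (normc_ge0 (K 1 0)) (h _ _).
    by rewrite ltr01 lexx.
  by rewrite in_itv /= oppr_le0 pi_ge0.
exists CK => // theta0 phi th0; have [t' [k [t'pi tE]]] := reduce_angle phi th0.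
exists `|t'| => // eps eps01; rewrite /=.
have -> : K eps (theta0 - angle phi) = K eps t'.
  by rewrite tE kernel_periodic_int.
have e0 : 0 < eps by case/andP: eps01.
have n0 := normc_ge0 (K eps t').
have nK : normc (K eps t') * (eps + `|t'|) ^+ 2 <= CK * eps.
  have s0 : 0 < eps + `|t'| by rewrite ltr_pwDl.
  have := CKP eps eps01 t' t'pi.
  case: m m_gt0 => // m' _.
  rewrite -(ler_pM2r (exprn_gt0 2 s0)) => /le_trans; apply.
  rewrite exprS.
  rewrite (_ : (_ ^- _) = (eps + `|t'|) ^- m' * (eps + `|t'|) ^- 2); last first.
    by rewrite -invfM -exprD addn2.
  rewrite -!mulrA mulVf ?expf_neq0 ?gt_eqF // mulr1 ler_wpM2l //.
  rewrite ler_piMr ?(ltW e0) // ler_pdivrMr ?exprn_gt0 // mul1r.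
  by rewrite lerXn2r ?nnegrE ?(ltW e0) ?(ltW s0) // lerDl.
have zk : normc ((expi (angle phi) - expi theta0) * K eps t') <=
    `|t'| * normc (K eps t').
  rewrite ComplexField.Normc.normcM ler_wpM2r //.
  have -> : theta0 = angle phi + t' + k%:~R * (2 * pi).
    by rewrite -addrA -tE; ring.
  rewrite (periodic_int (@expi_periodic R)) (le_trans (normc_expiB_le _ _)) //.
  by rewrite opprD addrA subrr sub0r normrN.
move: (normc (_ * _))
  (normc_ge0 ((expi (angle phi) - expi theta0) * K eps t')) zk.
move: (normc _) n0 nK => n n0 nK z z0 zk.
have := normr_ge0 t'; move: (`|t'|) nK zk => t nK zk t0.
have et0 : 0 <= eps * t by rewrite mulr_ge0 // ltW.
have tn : t * n <= CK.
  rewrite -(ler_pM2r e0); apply: le_trans nK.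
  have : 0 <= n * (eps ^+ 2 + eps * t + t ^+ 2).
    by rewrite mulr_ge0 // !addr_ge0 // sqr_ge0.
  by nra.
split => //; first exact: le_trans zk tn.
  apply: le_trans (ler_wpM2l t0 zk) _; apply: le_trans nK.
  have : 0 <= n * (eps ^+ 2 + 2 * (eps * t)).
    by rewrite mulr_ge0 // addr_ge0 ?sqr_ge0 // mulr_ge0.
  by nra.
rewrite ler_pdivlMr // -(ler_pM2r e0); apply: le_trans nK.
have : 0 <= n * (2 * (eps * t) + t ^+ 2).
  by rewrite mulr_ge0 // addr_ge0 ?sqr_ge0 // mulr_ge0.
by nra.
Qed.

Variable theta0 : R.
Hypothesis theta0_pi : theta0 \in `[- pi, pi]%R.

Lemma bounded_measurable_kernel (eps : R) : 0 < eps <= 1 ->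
  bounded_measurablec (fun phi : per R => K eps (theta0 - angle phi)).
Proof.
move=> eps01.
have ms : measurable_fun setT (fun phi : per R => theta0 - angle phi).
  by apply: measurable_funB; [exact: measurable_cst|exact: measurable_angle].
apply: bounded_measurablecP.
- have := continuous_measurable_fun (kernel_continuous_Re K_kernel eps01).
  by move=> /measurableT_comp; apply.
- have := continuous_measurable_fun (kernel_continuous_Im K_kernel eps01).
  by move=> /measurableT_comp; apply.
- have [CK _ H] := kernel_bound; exists (CK / eps) => phi.
  by have [t _ /(_ eps eps01)[]] := H theta0 phi theta0_pi.
Qed.

Variable nu : {measure set (per R) -> \bar R}.
Hypothesis nu_fin : (nu setT < +oo)%E.

Let z (eps : R) (phi : per R) : R :=
  normc ((expi (angle phi) - expi theta0) * K eps (theta0 - angle phi)).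

(** The parameter is capped at 1, beyond which nothing is known of the kernel:
    dominated convergence along a sequence needs its hypotheses at every index. *)
Lemma residual_cvg0 :
  \int[nu]_phi (z (Num.min eps 1) phi ^+ 2) @[eps --> 0^'+] --> (0 : R).
Proof.
apply/cvg_at_rightP => u [u0 ul].
have e01 n : 0 < Num.min (u n) 1 <= 1.
  by rewrite lt_min u0 ltr01 ge_min lexx orbT.
have [CK CK0 KB] := kernel_bound.
have bz n : bounded_measurable (fun phi => z (Num.min (u n) 1) phi ^+ 2).
  apply: bounded_measurable_normc_sqr; apply: bounded_measurablecM.
    apply: bounded_measurablecB; first exact: bounded_measurable_expi.
    exact: bounded_measurablec_cst.
  exact: bounded_measurable_kernel.
have := @dominated_convergence _ _ _ nu setT measurableT
  (fun n phi => (z (Num.min (u n) 1) phi ^+ 2)%:E) (cst 0%E) (cst (CK ^+ 2)%:E).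
case.
- by move=> n; apply/measurable_EFinP; exact: (bz n).1.
- exact: measurable_cst.
- apply: aeW => phi _; have [t t0 tP] := KB theta0 phi theta0_pi.
  apply: cvg_EFin; first exact: nearW.
  have [{}t0|t0'] := eqVneq t 0.
    rewrite (_ : _ \o _ = cst 0); first exact: cvg_cst.
    apply/funext => n /=; have [+ _ _ _] := tP _ (e01 n).
    rewrite t0 mul0r -/(z _ _) => h; apply/eqP.
    by rewrite sqrf_eq0 eq_le h normc_ge0.
  have tp : 0 < t by rewrite lt_neqAle eq_sym t0'.
  (* One factor z is bounded by CK, the other one by (CK / t) eps. *)
  apply: (@squeeze_cvgr _ _ _ _ (cst 0) (fun n => CK * (CK / t) * u n)).
  + apply: nearW => n /=; rewrite sqr_ge0 /=.
    have [_ h1 h2 _] := tP _ (e01 n); move: h1 h2; rewrite -/(z _ _) => h1 h2.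
    have zu : z (Num.min (u n) 1) phi <= CK / t * u n.
      rewrite mulrAC ler_pdivlMr // mulrC (le_trans h2) // ler_wpM2l //.
      by rewrite ge_min lexx.
    by rewrite expr2 -mulrA; apply: ler_pM => //; exact: normc_ge0.
  + exact: cvg_cst.
  + by rewrite -(mulr0 (CK * (CK / t))); apply: cvgM => //; exact: cvg_cst.
- apply: bounded_measurable_integrable => //; exact: bounded_measurable_cst.
- apply: aeW => phi n _; have [t t0 tP] := KB theta0 phi theta0_pi.
  have [_ h1 _ _] := tP _ (e01 n).
  by rewrite /= lee_fin ger0_norm ?sqr_ge0 // lerXn2r ?nnegrE ?normc_ge0.
by move=> _ _; rewrite integral0 => /fine_cvg.
Qed.

(** The integrand is bounded below by (b / eps)^2 times the indicator of the arc
    of radius c = eta eps / 2. The factor 1 / 2 makes the closed arc fit into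
    the open condition |theta| < eta eps. *)
Lemma filtered_mass_ge (eta : R) : 0 < eta ->
  (0 < limf_einf (fun eps : R =>
    ereal_inf [set (eps * normc (K eps theta))%R%:E |
               theta in [set theta : R | (`|theta| < eta * eps)%R]]) 0^'+)%E ->
  (0 < limf_einf (fun c : R =>
         nu (per_arc theta0 c) * (c ^- 2)%R%:E) 0^'+)%E ->
  exists2 a : R, 0 < a & \forall eps \near 0^'+,
    a <= \int[nu]_phi (normc (K eps (theta0 - angle phi)) ^+ 2).
Proof.
move=> eta0 /limf_einf_gt0[b b0 bK] /limf_einf_gt0[a a0 /near_right0[r r0 aP]].
exists (b ^+ 2 * (a * (eta / 2) ^+ 2)).
  by rewrite !mulr_gt0 ?exprn_gt0 // divr_gt0.
near=> eps.
have e0 : 0 < eps by near: eps; exact: nbhs_right_gt.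
have e1 : eps <= 1 by near: eps; apply: nbhs_right_le.
have e01 : 0 < eps <= 1 by rewrite e0 e1.
pose c := eta / 2 * eps.
have c0 : 0 < c by rewrite mulr_gt0 // divr_gt0.
have cr : c < r.
  rewrite -ltr_pdivlMl ?divr_gt0 //; near: eps; apply: nbhs_right_lt.
  by rewrite mulr_gt0 // invr_gt0 divr_gt0.
have Kb t : `|t| <= c -> b <= eps * normc (K eps t).
  move=> tc.
  have bE : (b%:E <= ereal_inf [set (eps * normc (K eps theta))%:E |
      theta in [set theta : R | (`|theta| < eta * eps)%R]])%E by near: eps.
  rewrite -lee_fin (le_trans bE) //; apply: ereal_inf_lbound; exists t => //=.
  by rewrite (le_lt_trans tc) // ltr_pM2r // ltr_pdivrMr // mulr2n; nra.
set S := per_arc theta0 c.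
have mS : measurable S by exact: measurable_per_arc.
have nuS : nu S \is a fin_num.
  by rewrite ge0_fin_numE // (le_lt_trans _ nu_fin) // le_measure ?inE.
have nuS_ge : a * c ^+ 2 <= fine (nu S).
  have := aP c; rewrite c0 cr => /(_ isT).
  by rewrite -/S -[nu S]fineK // -EFinM lee_fin ler_pdivlMr // exprn_gt0.
have bK2 := bounded_measurable_normc_sqr (bounded_measurable_kernel e01).
have bS := @bounded_measurable_indic _ _ R _ mS.
apply: (@le_trans _ _ (\int[nu]_phi ((b / eps) ^+ 2 * \1_S phi))); last first.
  apply: le_Rintegral => //; try exact: bounded_measurable_integrable.
    apply: bounded_measurable_integrable => //; exact: bounded_measurableZ.
  move=> phi _; rewrite indicE; case: (boolP (phi \in S)); last first.
    by rewrite mulr0 sqr_ge0.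
  rewrite inE => -[k]; rewrite in_itv /= => /andP[k1 k2].
  rewrite mulr1 lerXn2r ?nnegrE ?normc_ge0 ?divr_ge0 ?(ltW b0) ?(ltW e0) //.
  rewrite ler_pdivrMr // mulrC.
  rewrite -(kernel_periodic_int e01 (- k)); apply: Kb.
  by rewrite mulrNz mulNr ler_norml; apply/andP; split; lra.
rewrite RintegralZl //; last exact: bounded_measurable_integrable.
rewrite [\int[nu]_x _]/Rintegral integral_indic // setIT.
have -> : b ^+ 2 * (a * (eta / 2) ^+ 2) = (b / eps) ^+ 2 * (a * c ^+ 2).
  by rewrite /c; field; rewrite gt_eqF.
by rewrite ler_wpM2l // sqr_ge0.
Unshelve. all: by end_near. Qed.

End kernel_limits.

Theorem theorem5p8 (R : realType) (d : nat)
  (Omega : set 'rV[R]_d) (Omega0 : Omega !=set0)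
  (omega : {measure set (borel_subset Omega0) -> \bar R})
  (F : borel_subset Omega0 -> borel_subset Omega0)
  (F_preserving : measure_preserving omega F)
  (F_invertible : invertible_mod_null omega F)
  (E : pvm omega (per R))
  (E_spectral : is_spectral_resolution E (koopman F))
  (m : nat) (m_gt0 : (0 < m)%N)
  (K : R -> R -> R[i]) (K_kernel : order_kernel m K)
  (KE : R -> R -> L2 omega -> L2 omega)
  (KE_convolution : forall eps : R, 0 < eps <= 1 ->
     is_convolution E (K eps) (KE eps))
  (theta0 : R) (theta0_pi : theta0 \in `[- pi, pi]%R)
  (g : L2 omega)
  (K_liminf : exists2 eta : R, 0 < eta &
     (0 < limf_einf (fun eps : R =>
            ereal_inf [set (eps * normc (K eps theta))%R%:E |
                       theta in [set theta : R | (`|theta| < eta * eps)%R]])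
          0^'+)%E)
  (xi_liminf :
     (0 < limf_einf (fun c : R =>
            spectral_measure E g (per_arc theta0 c) * (c ^- 2)%R%:E) 0^'+)%E) :
  let g_ (eps : R) := KE eps theta0 g in
  L2norm (koopman F (g_ eps) - expi theta0 *: g_ eps) / L2norm (g_ eps)
    @[eps --> 0^'+] --> (0 : R).
Proof.
move=> g_.
have [eta eta0 Keta] := K_liminf.
have iU : pvm_integral E (fun phi => expi (angle phi)) (koopman F).
  by have [lU _ iU] := E_spectral; split.
have bU := @bounded_measurable_expi R.
have bc := @bounded_measurablec_cst _ (per R) _ (expi theta0).
have iD := pvm_integralB bU bc iU (pvm_integral_cst E (expi theta0)).
have bD := bounded_measurablecB bU bc.
have iK eps : 0 < eps <= 1 ->
    pvm_integral E (fun phi => K eps (theta0 - angle phi)) (KE eps theta0).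
  by move=> /KE_convolution/(_ theta0)[lK _ iK]; split.
have bK eps (eps01 : 0 < eps <= 1) :=
  bounded_measurable_kernel m_gt0 K_kernel theta0_pi eps01.
have [a a0 den] := filtered_mass_ge m_gt0 K_kernel theta0_pi
  (spectral_measure_fin E g) eta0 Keta xi_liminf.
have /cvgrPdist_le num := residual_cvg0 m_gt0 K_kernel theta0_pi
  (spectral_measure_fin E g).
apply/cvgrPdist_le => e e0.
(* The mass is at least a, so a residual below e^2 a has norm ratio below e. *)
have ea0 : 0 < e ^+ 2 * a by rewrite mulr_gt0 ?exprn_gt0.
have {}num := num _ ea0.
near=> eps.
have eps0 : 0 < eps by near: eps; exact: nbhs_right_gt.
have eps1 : eps <= 1 by near: eps; apply: nbhs_right_le.
have eps01 : 0 < eps <= 1 by rewrite eps0 eps1.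
rewrite sub0r normrN ger0_norm ?divr_ge0 ?sqrtr_ge0 //.
have den_eps : a <= Re (dot (g_ eps) (g_ eps)).
  rewrite (pvm_integral_norm g (bK _ eps01) (iK _ eps01)).
  by near: eps; exact: den.
have num_eps : Re (dot (koopman F (g_ eps) - expi theta0 *: g_ eps)
    (koopman F (g_ eps) - expi theta0 *: g_ eps)) <= e ^+ 2 * a.
  have iM := pvm_integralM bD (bK _ eps01) iD (iK _ eps01).
  rewrite (pvm_integral_norm g (bounded_measurablecM bD (bK _ eps01)) iM).
  have : `|0 - \int[spectral_measure E g]_phi
      (normc ((expi (angle phi) - expi theta0) *
              K (Num.min eps 1) (theta0 - angle phi)) ^+ 2)| <= e ^+ 2 * a.
    by near: eps; exact: num.
  rewrite (min_idPl eps1) sub0r normrN => /(le_trans _); apply.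
  exact: ler_norm.
have den0 : 0 < L2norm (g_ eps) by rewrite sqrtr_gt0 (lt_le_trans a0).
rewrite ler_pdivrMr // /L2norm -[e]ger0_norm ?(ltW e0) // -sqrtr_sqr.
rewrite -sqrtrM ?sqr_ge0 //.
by rewrite ler_wsqrtr // (le_trans num_eps) // ler_wpM2l ?sqr_ge0.
Unshelve. all: by end_near. Qed.
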